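(* For every constant $c > 0$ there exists a constant $C > 0$ such that the following holds. For all integers $n \ge 1$ and $p \ge 1$, all $0 < \varepsilon < 1$ and all $\delta$ with $n^{-c} \le \delta < 1$, in the multi-processor cup game on $n$ cups with $p$ processors and parameters $\varepsilon, \delta$, if the emptier follows the greedy algorithm then, against every filler strategy, the backlog after every step is at most $C \varepsilon^{-1} \max(1, \log n)$.
   Context: Multi-processor cup game with parameters $p,\varepsilon,\delta$: $n$ cups, initially empty. In each step $i$, the filler pours nonnegative amounts $c_j(i)$ into the cups with $c_j(i) \le 1-\delta$ for every cup $j$ and $\sum_j c_j(i) \le (1-\varepsilon)p$; then the emptier removes up to one unit of water from each of up to $p$ distinct cups. The greedy algorithm: in each step the emptier removes $\min(1, \text{fill})$ units from each of the $p$ fullest cups (ties broken arbitrarily). The backlog after a step is the maximum amount of water in any cup. *)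

(* Defs.v *)
From HB Require Import structures.
From mathcomp Require Import all_boot all_order all_algebra.
From mathcomp Require Import reals exp.
Set Implicit Arguments.
Unset Strict Implicit.
Unset Printing Implicit Defensive.
Import Order.TTheory GRing.Theory Num.Theory.
Local Open Scope ring_scope.

(* The amounts of water in n cups. *)
Definition cups (R : realType) (n : nat) := 'I_n -> R.

Definition filler_move (R : realType) (n p : nat) (eps delta : R)
    (pour : cups R n) : Prop :=
  [/\ forall j, 0 <= pour j,
      forall j, pour j <= 1 - delta
    & \sum_(j < n) pour j <= (1 - eps) * p%:R].

(* S consists of p fullest cups of the state g (all the cups if n <= p);
   when there are ties, several sets S qualify. *)
Definition fullest (R : realType) (n p : nat) (g : cups R n)
    (S : {set 'I_n}) : Prop :=
  #|S| = minn p n /\ forall i j, i \in S -> j \notin S -> g j <= g i.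

(* A step from state f to state f': the filler pours, and the emptier then
   acts greedily on the resulting state g. *)
Definition greedy_step (R : realType) (n p : nat) (eps delta : R)
    (f f' : cups R n) : Prop :=
  exists pour : cups R n, filler_move p eps delta pour /\
    let g : cups R n := fun j => f j + pour j in
    exists S : {set 'I_n}, fullest p g S /\
      forall j, f' j = if j \in S then g j - Num.min 1 (g j) else g j.

(* A play of the game against the greedy emptier; f t is the state after t
   steps. An adaptive filler that sees the whole past, including how ties are
   broken, can produce exactly these sequences of states. *)
Definition greedy_play (R : realType) (n p : nat) (eps delta : R)
    (f : nat -> cups R n) : Prop :=
  (forall j, f 0%N j = 0) /\
  forall t, greedy_step p eps delta (f t) (f t.+1).

(* Fills are nonnegative, so the default value 0 does not affect the maximum
   when n >= 1. *)
Definition backlog (R : realType) (n : nat) (f : cups R n) : R :=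
  \big[Num.max/0]_(j < n) f j.

(* Main.v *)
Require Import Defs.
From HB Require Import structures.
From mathcomp Require Import all_boot all_order all_algebra.
From mathcomp Require Import reals exp.
From mathcomp Require Import sequences lra ring.
Set Implicit Arguments.
Unset Strict Implicit.
Unset Printing Implicit Defensive.
Import Order.TTheory GRing.Theory Num.Theory.
Local Open Scope ring_scope.

(** The potential [\sum_j (expR (eps * f j) - 1)] never exceeds
    [n * expR 2 / delta].  If every emptied cup holds at least one unit after
    the pour, then by convexity the potential does not increase: all emptied
    cups are at least as full as all the others, and the amount poured outside
    of the emptied cups is at most [1 - eps <= expR (- eps)] times the net
    decrease of the emptied cups.  Otherwise every cup ends at level at most
    [1] or loses at least [delta], and the potential contracts by
    [expR (- (eps * delta))] up to an additive [n * (expR eps - 1)].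
    Subtracting [1] from each exponential makes this term proportional to
    [eps], which avoids a [ln (eps^-1)] in the backlog. *)

Definition potential (R : realType) (n : nat) (eps : R) (f : cups R n) : R :=
  \sum_(j < n) (expR (eps * f j) - 1).

Lemma greedy_step_ge0 (R : realType) (n p : nat) (eps delta : R)
    (f f' : cups R n) :
  greedy_step p eps delta f f' -> (forall j, 0 <= f j) -> forall j, 0 <= f' j.
Proof.
move=> [c [[c0 _ _] [S [_ f'E]]]] f0 j; rewrite f'E.
by case: ifP => _; rewrite ?subr_ge0 ?ge_min ?lexx ?orbT ?addr_ge0.
Qed.

(** If [n <= p], then [S] contains every cup and the left side is empty. Otherwise [S] has [p] cups;
    with [a] the amount poured into [S], the budget leaves [(1 - eps) * p - a], which is at most
    [(1 - eps) * (p - a)]. *)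
Lemma pour_outside_fullest (R : realType) (n p : nat) (eps delta : R)
    (c g : cups R n) (S : {set 'I_n}) :
  0 < eps < 1 -> 0 <= delta -> filler_move p eps delta c -> fullest p g S ->
  \sum_(j | j \notin S) c j <= (1 - eps) * \sum_(j in S) (1 - c j).
Proof.
move=> /andP[e0 e1] d0 [c0 cd csum] [cardS _].
have u0 : 0 <= \sum_(j in S) (1 - c j).
  by apply: sumr_ge0 => j _; have := cd j; lra.
have [np|pn] := leqP n p.
  rewrite big1 ?mulr_ge0 ?subr_ge0 ?(ltW e1)// => j.
  suff -> : S = [set: 'I_n] by rewrite inE.
  by apply/eqP; rewrite eqEcard subsetT cardsT card_ord cardS (minn_idPr np) /=.
have uE : \sum_(j in S) (1 - c j) = p%:R - \sum_(j in S) c j.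
  by rewrite sumrB sumr_const cardS (minn_idPl (ltnW pn)).
have cS0 : 0 <= \sum_(j in S) c j by apply: sumr_ge0.
move: csum; rewrite (bigID (mem S))/= uE.
set a := \sum_(j in S) _; set b := \sum_(j | _) _ => ab.
have : 0 <= eps * a by rewrite mulr_ge0 // ltW.
by move: ab; lra.
Qed.

Lemma potential_decreasing (R : realType) (n p : nat) (eps delta : R)
    (f f' c : cups R n) (S : {set 'I_n}) :
  0 < eps < 1 -> 0 <= delta -> (0 < n)%N -> (0 < p)%N ->
  filler_move p eps delta c ->
  fullest p (fun j => f j + c j) S ->
  (forall j, j \in S -> f' j = f j + c j - 1) ->
  (forall j, j \notin S -> f' j = f j + c j) ->
  potential eps f' <= potential eps f.
Proof.
move=> eps01 d0 n0 p0 hc hS inS outS.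
have := pour_outside_fullest eps01 d0 hc hS.
have /andP[e0 e1] := eps01.
have [c0 cd _] := hc; have [cardS leS] := hS.
have [i0 i0S] : exists i, i \in S.
  by apply/set0Pn; rewrite -card_gt0 cardS leq_min p0.
have [i iS imin] := arg_minP (fun j => f j + c j) i0S.
(* [th] is the common rate separating the two groups: each unit poured outside [S] costs at most
   [eps * th], and each unit of net loss inside [S] gains at least [eps * th * (1 - eps)]. The
   hypothesis [outside] balances the two. *)
set th := expR (eps * (f i + c i)); move=> outside.
have outB j : j \notin S ->
    expR (eps * f' j) - expR (eps * f j) <= eps * th * c j.
  move=> jS; rewrite outS //.
  have -> : eps * f j = eps * (f j + c j) - eps * c j by ring.
  rewrite expRD; set x := expR (eps * (f j + c j)).
  have x0 : 0 <= x by exact: expR_ge0.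
  have xth : x <= th by rewrite ler_expR ler_pM2l // leS.
  have h1 : x * (1 - eps * c j) <= x * expR (- (eps * c j)).
    by rewrite ler_wpM2l // expR_ge1Dx.
  have h2 : x * (eps * c j) <= th * (eps * c j).
    by rewrite ler_wpM2r // mulr_ge0 // ltW.
  by move: h1 h2; lra.
have inB j : j \in S ->
    expR (eps * f' j) - expR (eps * f j)
    <= - (eps * th * (1 - eps) * (1 - c j)).
  move=> jS; rewrite inS //; have u0 : 0 <= 1 - c j by have := cd j; lra.
  have -> : eps * f j = eps * (f j + c j - 1) + eps * (1 - c j) by ring.
  rewrite expRD; set x := expR (eps * (f j + c j - 1)).
  (* The removed unit lowers the exponential by the factor [expR (- eps)], which is at least
     [1 - eps]. *)
  have xth : th * (1 - eps) <= x.
    rewrite (@le_trans _ _ (th * expR (- eps))) //.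
      by rewrite ler_wpM2l ?expR_ge0 ?expR_ge1Dx.
    by rewrite -expRD ler_expR -[X in _ - X]mulr1 -mulrBr ler_pM2l // lerB // imin.
  have h1 : x * (1 + eps * (1 - c j)) <= x * expR (eps * (1 - c j)).
    by rewrite ler_wpM2l ?expR_ge0 ?expR_ge1Dx.
  have h2 : th * (1 - eps) * (eps * (1 - c j)) <= x * (eps * (1 - c j)).
    by rewrite ler_wpM2r // mulr_ge0 // ltW.
  by move: h1 h2; lra.
rewrite -subr_le0 /potential -sumrB.
under eq_bigr => j _ do rewrite opprB addrA subrK.
rewrite (bigID (mem S))/= (le_trans (lerD (ler_sum _ inB) (ler_sum _ outB))) //.
rewrite sumrN -!mulr_sumr addrC subr_le0 -[leRHS]mulrA ler_wpM2l //.
by rewrite mulr_ge0 ?expR_ge0 // ltW.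
Qed.

(** The bound holds cup by cup: a cup ending at level at most [1] is paid for by [expR eps - 1], and
    a loss of [delta] multiplies the exponential by at most [expR (- (eps * delta))]. *)
Lemma potential_contracting (R : realType) (n : nat) (eps delta : R)
    (f f' : cups R n) :
  0 < eps -> 0 < delta -> (forall j, 0 <= f j) ->
  (forall j, f' j <= 1 \/ f' j <= f j - delta) ->
  potential eps f'
  <= n%:R * (expR eps - 1) + expR (- (eps * delta)) * potential eps f.
Proof.
move=> e0 d0 f0 hf'; rewrite /potential mulr_sumr mulr_natl.
rewrite -[X in _ *+ X]card_ord -sumr_const -big_split /=.
apply: ler_sum => j _.
have q0 := expR_ge0 (- (eps * delta)).
have q1 : expR (- (eps * delta)) <= 1 by rewrite -expR0 ler_expR oppr_le0 ltW ?mulr_gt0.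
have e1 : 1 <= expR eps by rewrite -expR0 ler_expR ltW.
have x1 : 1 <= expR (eps * f j) by rewrite -expR0 ler_expR mulr_ge0 // ltW.
have [h|h] := hf' j.
  have : expR (eps * f' j) <= expR eps by rewrite ler_expR -[leRHS]mulr1 ler_pM2l.
  have : 0 <= expR (- (eps * delta)) * (expR (eps * f j) - 1).
    by rewrite mulr_ge0 // subr_ge0.
  by lra.
have : expR (eps * f' j) <= expR (- (eps * delta)) * expR (eps * f j).
  by rewrite -expRD ler_expR addrC -mulrBr ler_pM2l.
by lra.
Qed.

Lemma potential_bound_step (R : realType) (n p : nat) (eps delta : R)
    (f f' : cups R n) :
  0 < eps < 1 -> 0 < delta < 1 -> (0 < n)%N -> (0 < p)%N ->
  greedy_step p eps delta f f' -> (forall j, 0 <= f j) ->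
  potential eps f <= n%:R * expR 2 / delta ->
  potential eps f' <= n%:R * expR 2 / delta.
Proof.
move=> eps01 /andP[d0 d1] n0 p0 [c [hc [S [hS f'E]]]] f0 hf.
have /andP[e0 e1] := eps01.
have [c0 cd _] := hc; have [_ leS] := hS.
have [/forall_inP full|] := boolP [forall (j | j \in S), 1 <= f j + c j].
  apply: le_trans hf; apply: (potential_decreasing eps01 (ltW d0) n0 p0 hc hS).
    by move=> j jS; rewrite f'E jS min_l // full.
  by move=> j jS; rewrite f'E (negbTE jS).
rewrite negb_forall => /existsP[i]; rewrite negb_imply -ltNge => /andP[iS gi1].
(* Cups outside [S] are no fuller than [i], hence below [1]. A cup in [S] is either emptied
   completely or loses [1 - c j >= delta] net. *)
have hf' j : f' j <= 1 \/ f' j <= f j - delta.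
  rewrite f'E; case: ifPn => [jS|jS]; last first.
    by left; apply: le_trans (ltW gi1); exact: leS.
  have [g1|g1] := leP 1 (f j + c j); last by left; rewrite subrr.
  by right; have := cd j; lra.
apply: le_trans (potential_contracting e0 d0 f0 hf') _.
set K := n%:R * expR 2 / delta in hf *.
set q := expR (- (eps * delta)).
have hqK : q * potential eps f <= q * K by rewrite ler_wpM2l // expR_ge0.
(* This says that the affine contraction maps [K] to at most [K]. *)
suff : n%:R * (expR eps - 1) <= (1 - q) * K by move: hqK; lra.
(* [expR eps - 1 <= eps * expR 1] and [1 - q >= eps * delta * expR (- 1)]. *)
have num : expR eps - 1 <= eps * expR 1.
  have h1 : expR eps * (1 - eps) <= 1.
    have : expR eps * (1 - eps) <= expR eps * expR (- eps).
      by rewrite ler_wpM2l ?expR_ge0 ?expR_ge1Dx.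
    by rewrite -expRD subrr expR0.
  have : eps * expR eps <= eps * expR 1 by rewrite ler_pM2l // ler_expR ltW.
  by move: h1; lra.
have den : eps * delta * expR (- 1) <= 1 - q.
  have ed0 : 0 < eps * delta by rewrite mulr_gt0.
  have ed1 : eps * delta <= 1 by rewrite mulr_ile1 // ltW.
  have h1 : q * (1 + eps * delta) <= 1.
    have : q * (1 + eps * delta) <= q * expR (eps * delta).
      by rewrite ler_wpM2l ?expR_ge0 ?expR_ge1Dx.
    by rewrite -expRD addNr expR0.
  have : eps * delta * expR (- 1) <= eps * delta * q.
    by rewrite ler_pM2l // ler_expR lerN2.
  by move: h1; lra.
have K0 : 0 <= K by rewrite divr_ge0 ?mulr_ge0 ?expR_ge0 // ltW.
apply: le_trans (ler_wpM2r K0 den).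
(* The factor [expR 2 / delta] in [K] is chosen for this equality: [delta] cancels, and one factor
   [expR 1] survives to match [num]. *)
have -> : eps * delta * expR (- 1) * K = n%:R * (eps * expR 1).
  rewrite /K (_ : 2 = 1 + 1 :> R) // expRD.
  transitivity (n%:R * (eps * expR 1) * (expR (- 1) * expR 1) : R).
    by field; rewrite gt_eqF.
  by rewrite -expRD addNr expR0 mulr1.
by rewrite ler_wpM2l.
Qed.

Theorem theorem5p1 (R : realType) (c : R) (hc : 0 < c) :
  exists2 C : R, 0 < C &
    forall (n p : nat) (eps delta : R),
      (1 <= n)%N -> (1 <= p)%N ->
      0 < eps < 1 ->
      n%:R `^ (- c) <= delta < 1 ->
      forall f : nat -> cups R n,
        greedy_play p eps delta f ->
        forall t : nat,
          backlog (f t.+1) <= C * eps^-1 * Num.max 1 (ln n%:R).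
Proof.
(* In the constant, [1 + c] comes from [n / delta <= n^(1 + c)], and [3] from absorbing [1 + expR 2]
   into [expR 3]. *)
exists (4 + c); first by lra.
move=> n p eps delta n0 p0 eps01 /andP[nd d1] f [f0 fS] t.
have /andP[e0 _] := eps01.
have nR0 : 0 < n%:R :> R by rewrite ltr0n.
have d0 : 0 < delta by apply: lt_le_trans nd; exact: powR_gt0.
have d01 : 0 < delta < 1 by rewrite d0.
have fge0 s j : 0 <= f s j.
  by elim: s j => [j|s IH]; [rewrite f0 | exact: greedy_step_ge0 (fS s) IH].
have pot s : potential eps (f s) <= n%:R * expR 2 / delta.
  elim: s => [|s IH].
    rewrite /potential big1 => [|j _]; last by rewrite f0 mulr0 expR0 subrr.
    by rewrite divr_ge0 ?mulr_ge0 ?expR_ge0 // ltW.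
  exact: potential_bound_step eps01 d01 n0 p0 (fS s) (fge0 s) IH.
set M := Num.max 1 (ln n%:R).
have M1 : 1 <= M by rewrite le_max lexx.
have Mln : ln n%:R <= M by rewrite le_max lexx orbT.
(* The first goal concerns the default value [0] of the maximum. *)
rewrite /backlog; apply/bigmax_leP; split => [|j _].
  by rewrite !mulr_ge0 ?invr_ge0 ?(ltW e0) //; lra.
rewrite mulrAC ler_pdivlMr // mulrC -ler_expR.
(* All terms of the potential are nonnegative because fills are, so a single cup is bounded by the
   whole sum. *)
have term : expR (eps * f t.+1 j) - 1 <= potential eps (f t.+1).
  rewrite /potential (bigD1 j) //= lerDl sumr_ge0 // => k _.
  by rewrite subr_ge0 -expR0 ler_expR mulr_ge0 // ltW.
have {term pot} := le_trans term (pot t.+1).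
have ninv : n%:R / delta <= expR ((1 + c) * ln n%:R).
  rewrite mulrDl mul1r expRD lnK ?posrE // ler_pM2l //.
  rewrite -[leRHS]invrK lef_pV2 ?posrE ?invr_gt0 ?expR_gt0 //.
  by apply: le_trans nd; rewrite /powR gt_eqF // mulNr expRN.
rewrite mulrAC => h.
have c1 : 0 <= 1 + c by move: hc; lra.
have A1 : 1 <= expR ((1 + c) * ln n%:R).
  by rewrite -[leLHS]expR0 ler_expR mulr_ge0 // ln_ge0 // ler1n.
have e2 : 1 <= expR 2 :> R by rewrite -[leLHS]expR0 ler_expR ler0n.
have e3 : 1 + expR 2 <= expR 3 :> R.
  rewrite (_ : 3 = 1 + 2 :> R); last by ring.
  have : (1 + 1) * expR 2 <= expR 1 * expR 2 :> R.
    by rewrite ler_pM2r ?expR_gt0 ?expR_ge1Dx.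
  by rewrite (expRD 1 2); move: e2; lra.
apply: (@le_trans _ _ (expR ((1 + c) * ln n%:R) * expR 3)).
  have h1 : n%:R / delta * expR 2 <= expR ((1 + c) * ln n%:R) * expR 2.
    by rewrite ler_pM2r // expR_gt0.
  have h2 : expR ((1 + c) * ln n%:R) * (1 + expR 2)
            <= expR ((1 + c) * ln n%:R) * expR 3.
    by rewrite ler_pM2l // expR_gt0.
  by move: h h1 h2 A1; lra.
(* What remains is [(1 + c) * ln n + 3 <= (4 + c) * M], where [1 <= M] absorbs the [3]. *)
rewrite -expRD ler_expR.
have := ler_wpM2l c1 Mln; move: M1; lra.
Qed.
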